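(* Let $n\geq3$, and suppose $B\in\mathcal{S}^n$ is such that $\|e_i+e_j\|_B>1$ for all $1\leq i<j\leq n$. Let $\mathcal{I}^{n-1}\bigl(\tfrac1n\bigr)$ be any subset of $G^{n-1}\bigl(\tfrac1n\bigr)$ of cardinality $2^{n-1}$ which deep illuminates every vector of $\mathbb{R}^{n-1}\setminus\{\vec{0}\}$. Then $B$ is illuminated by the set $$\bigl[\mathcal{I}^{n-1}\bigl(\tfrac1n\bigr)\times\{0\}\bigr]\cup\{\pm e_n\}.$$ Thus $\mathfrak{I}(B)\leq2^{n-1}+2$.
   Context: A convex body in $\mathbb{R}^n$ is a compact convex set with non-empty interior. A convex body $B\subset\mathbb{R}^n$ is 1-symmetric if $(x_1,\ldots,x_n)\in B$ implies $(\epsilon_1x_{\sigma(1)},\ldots,\epsilon_nx_{\sigma(n)})\in B$ for all signs $\epsilon_i\in\{\pm1\}$ and all permutations $\sigma$ of $[n]=\{1,\ldots,n\}$. For such $B$, $\|x\|_B=\inf\{t>0:x\in tB\}$. $\mathcal{S}^n$ denotes the class of 1-symmetric convex bodies $B\subset\mathbb{R}^n$ with $\|e_i\|_B=1$ for all standard basis vectors $e_i$. (The hypothesis $\|e_i+e_j\|_B>1$ for all $i<j$ says that $e_1+e_2\notin B$.) A direction is a non-zero vector; $d$ illuminates a boundary point $x$ of a convex body $K$ if there is $\varepsilon>0$ with $x+\varepsilon d\in\operatorname{int}K$; a set of directions illuminates $K$ if every boundary point of $K$ is illuminated by at least one of its elements; $\mathfrak{I}(K)$ is the smallest cardinality of a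 set of directions illuminating $K$. For $m\geq2$ and $\delta\in(0,1)$, $G^m(\delta)$ is the set of all $d\in\mathbb{R}^m$ for which there is $i\in[m]$ with $|d_i|=1$ and $|d_j|=\delta$ for all $j\neq i$. A set $\mathcal{I}\subset G^m(\delta)$ deep illuminates $x\in\mathbb{R}^m\setminus\{\vec0\}$ if there is $d\in\mathcal{I}$ such that $\operatorname{sign}(x_i)=-\operatorname{sign}(d_i)$ for every $i$ with $x_i\neq0$, and moreover $|d_j|=1$ for some $j$ with $x_j\neq0$. (For every $m\ge 2$ and $\delta\in(0,1)$ there exist subsets of $G^m(\delta)$ of cardinality $2^m$ which deep illuminate every non-zero vector of $\mathbb{R}^m$.) *)

(* Defs.v *)
From HB Require Import structures.
From mathcomp Require Import all_boot all_order all_algebra all_fingroup.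
From mathcomp Require Import all_classical all_reals all_analysis.

Set Implicit Arguments.
Unset Strict Implicit.
Unset Printing Implicit Defensive.

Import Order.TTheory GRing.Theory Num.Theory.
Import numFieldNormedType.Exports.

Local Open Scope classical_set_scope.
Local Open Scope card_scope.
Local Open Scope ring_scope.

Definition convex_body (R : realType) (n : nat) (K : set 'rV[R]_n) : Prop :=
  [/\ compact K, convex_set K & K° !=set0].

(* The topology on row vectors is that of the sup norm, hence the usual one. *)
Definition boundary (R : realType) (n : nat) (K : set 'rV[R]_n) :
    set 'rV[R]_n :=
  closure K `\` K°.

Definition one_symmetric (R : realType) (n : nat) (K : set 'rV[R]_n) : Prop :=
  forall (eps : 'I_n -> bool) (s : 'S_n) (x : 'rV[R]_n),
    K x -> K (\row_i ((-1) ^+ eps i * x 0 (s i))).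

Definition gauge_norm (R : realType) (n : nat) (K : set 'rV[R]_n)
    (x : 'rV[R]_n) : R :=
  inf [set t : R | 0 < t /\ [set t *: y | y in K] x].

Definition basis_vec (R : realType) (n : nat) (i : 'I_n) : 'rV[R]_n :=
  delta_mx 0 i.

Definition sym_body_class (R : realType) (n : nat) : set (set 'rV[R]_n) :=
  [set K | [/\ convex_body K, one_symmetric K
             & forall i : 'I_n, gauge_norm K (basis_vec R i) = 1]].

Definition illuminates_point (R : realType) (n : nat) (K : set 'rV[R]_n)
    (d x : 'rV[R]_n) : Prop :=
  exists2 eps : R, 0 < eps & K° (x + eps *: d).

Definition illuminates (R : realType) (n : nat) (D K : set 'rV[R]_n) : Prop :=
  (forall d, D d -> d != 0) /\
  (forall x, boundary K x -> exists2 d, D d & illuminates_point K d x).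

(* Smallest cardinality of an illuminating set; the infimum of a set of natural
   numbers is attained, and it is +oo when no finite set illuminates. *)
Definition illumination_number (R : realType) (n : nat) (K : set 'rV[R]_n) :
    \bar R :=
  ereal_inf [set (k%:R)%:E | k in
    [set k : nat | exists2 D : set 'rV[R]_n, D #= `I_k & illuminates D K]].

Definition Gset (R : realType) (m : nat) (delta : R) : set 'rV[R]_m :=
  [set d | exists i : 'I_m,
     `|d 0 i| = 1 /\ forall j : 'I_m, j != i -> `|d 0 j| = delta].

Definition deep_illuminates (R : realType) (m : nat) (D : set 'rV[R]_m)
    (x : 'rV[R]_m) : Prop :=
  exists2 d, D d &
    (forall i, x 0 i != 0 -> Num.sg (x 0 i) = - Num.sg (d 0 i)) /\
    (exists2 j, x 0 j != 0 & `|d 0 j| = 1).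

(* The embedding d |-> (d, 0) of R^n into R^(n+1): [unlift ord_max i] is [None]
   at the last index and otherwise returns [i] as an element of ['I_n]. *)
Definition append0 (R : realType) (n : nat) (d : 'rV[R]_n) : 'rV[R]_n.+1 :=
  \row_i (if unlift ord_max i is Some j then d 0 j else 0).

(* Main.v *)
Require Import Defs.
From HB Require Import structures.
From mathcomp Require Import all_boot all_order all_algebra all_fingroup.
From mathcomp Require Import all_classical all_reals all_analysis.
From mathcomp Require Import lra ring.

Set Implicit Arguments.
Unset Strict Implicit.
Unset Printing Implicit Defensive.

Import Order.TTheory GRing.Theory Num.Theory.
Import numFieldNormedType.Exports.

Local Open Scope classical_set_scope.
Local Open Scope card_scope.
Local Open Scope ring_scope.

(** Write N for the dimension and l for the last coordinate.  A 1-symmetric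
    convex body B is solid: membership depends only on the moduli of the
    coordinates and is monotone in them (unconditional_solid).  So a point is
    interior as soon as some point of B dominates it strictly in every
    coordinate (solid_interior), and illuminating x by d means finding, for
    some e > 0, a point of B that strictly dominates x + e d.

    The dominating points come from exchanging coordinates: averaging x with
    its images under the transpositions (j k), k in A, moves mass from the
    coordinate j to the coordinates in A (transfer_mass).  Let x be a boundary
    point.  All its coordinates have modulus at most 1, because the basis
    vectors have norm 1.

    If the last coordinate of x has modulus 1, all the others are smaller,
    since a second one would put a vector e_i + e_l into B.  Moving toward the
    hyperplane where the last coordinate vanishes frees some height, and giving
    part of that height to the other coordinates, all of which are lower,
    raises each of them strictly (interior_under_tip).

    If the last coordinate of x has modulus less than 1, the remaining
    coordinates do not all vanish: otherwise x would lie inside B, strictly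
    below the tip e_l.  A direction d that deep illuminates the vector of
    these coordinates lowers the nonzero ones, among them some j at full speed
    1, and moves the zero ones at speed only 1/N.  There are at most N-2 zeros
    to feed, so the mass lost at j more than pays for them.  This gives strict domination
    except in the coordinate l, which d does not move; since |x_l| < 1, mixing
    in a little of the tip e_l makes it strict there too
    (illuminates_off_axis, interior_off_axis).

    The bound on the illumination number needs one deep illuminating family of
    the right size.  It is indexed by sign vectors: the entry of modulus 1 is
    put at the end of the initial run of equal signs (run_dir). *)

(** * Symmetric convex sets are solid *)

Lemma convex_set_comb (R : realType) (n : nat) (K : set 'rV[R]_n)
    (x y : 'rV[R]_n) (t : R) :
  convex_set K -> 0 <= t <= 1 -> K x -> K y -> K (t *: x + (1 - t) *: y).
Proof.
move=> cK /andP[t0 t1] Kx Ky.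
have := cK x y (Itv01 t0 t1); rewrite !inE => /(_ Kx Ky).
by [].
Qed.

(** The total weight is left arbitrary, so that the induction needs no
    renormalisation and the sum can enter a larger convex combination. *)
Lemma convex_set_sum (R : realType) (n : nat) (K : set 'rV[R]_n)
    (I : Type) (s : seq I) (P : pred I) (w : I -> R) (v : I -> 'rV[R]_n) :
  convex_set K -> K !=set0 -> (forall i, 0 <= w i) -> (forall i, K (v i)) ->
  exists2 u, K u &
    \sum_(i <- s | P i) w i *: v i = (\sum_(i <- s | P i) w i) *: u.
Proof.
move=> cK [u0 Ku0] w0 Kv; elim: s => [|i s [u Ku IH]].
  by exists u0; rewrite // !big_nil scale0r.
rewrite !big_cons IH; case: ifP => _; last by exists u.
set W := \sum_(j <- s | P j) w j.
have W0 : 0 <= W by exact: sumr_ge0.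
have [wW|wW] := eqVneq (w i + W) 0.
  exists u0; rewrite // wW scale0r.
  have /andP[/eqP -> /eqP ->] : (w i == 0) && (W == 0).
    by rewrite -paddr_eq0 // wW.
  by rewrite !scale0r addr0.
exists ((w i / (w i + W)) *: v i + (1 - w i / (w i + W)) *: u).
  apply: convex_set_comb => //.
  rewrite divr_ge0 ?addr_ge0 //= ler_pdivrMr ?mul1r ?lerDl //.
  by rewrite lt_def wW addr_ge0.
rewrite scalerDr !scalerA; congr (_ *: _ + _ *: _); by field.
Qed.

(** A single coordinate can be shrunk because a point and its mirror image in
    that coordinate both lie in K, hence so does the segment between them; the
    coordinates are then treated one after the other. *)
Lemma unconditional_solid (R : realType) (n : nat) (K : set 'rV[R]_n)
    (z y : 'rV[R]_n) :
  convex_set K -> one_symmetric K -> K z ->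
  (forall i, `|y 0 i| <= `|z 0 i|) -> K y.
Proof.
move=> cK sK Kz yz.
have shrink (u : 'rV[R]_n) i t : K u -> `|t| <= `|u 0 i| ->
    K (\row_j (if j == i then t else u 0 j)).
  move=> Ku tu; have [ui0|ui0] := eqVneq (u 0 i) 0.
    suff -> : \row_j (if j == i then t else u 0 j) = u by [].
    apply/rowP => j; rewrite mxE; case: eqP => // ->.
    by move: tu; rewrite ui0 normr0 normr_le0 => /eqP.
  have Ku' := sK (fun j => j == i) 1%g u Ku.
  have tu1 : `|t / u 0 i| <= 1.
    by rewrite normrM normfV ler_pdivrMr ?mul1r // normr_gt0.
  have l01 : 0 <= (1 + t / u 0 i) / 2 <= 1.
    by move: tu1; rewrite ler_norml => /andP[? ?]; apply/andP; split; lra.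
  have := convex_set_comb cK l01 Ku Ku'.
  congr (K _); apply/rowP => j; rewrite !mxE perm1.
  by case: eqP => [->|_]; rewrite ?expr1 ?expr0; field.
have H (s : seq 'I_n) : K (\row_j (if j \in s then y 0 j else z 0 j)).
  elim: s => [|a s IH].
    by congr (K _): Kz; apply/rowP => j; rewrite mxE.
  have le_ya : `|y 0 a| <= `|(\row_j (if j \in s then y 0 j else z 0 j)) 0 a|.
    by rewrite mxE; case: ifP.
  congr (K _): (shrink _ _ _ IH le_ya); apply/rowP => j.
  by rewrite !mxE in_cons; case: eqP => [->|].
by congr (K _): (H (enum 'I_n)); apply/rowP => j; rewrite mxE mem_enum.
Qed.

Lemma solid_interior (R : realType) (n : nat) (K : set 'rV[R]_n)
    (z y : 'rV[R]_n) :
  convex_set K -> one_symmetric K -> K z ->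
  (forall i, `|y 0 i| < `|z 0 i|) -> K° y.
Proof.
move=> cK sK Kz yz; rewrite /interior.
have : nbhs y [set w : 'rV[R]_n | forall i, `|w 0 i| < `|z 0 i|].
  apply: (@filter_forall _ _ (fun i (w : 'rV[R]_n) => `|w 0 i| < `|z 0 i|) (nbhs y)) => i.
  have cy : (fun w : 'rV[R]_n => `|w 0 i|) @ y --> `|y 0 i|.
    exact: cvg_norm (@coord_continuous R 1 n 0 i y).
  exact: (cvgr_lt _ cy).
apply: filterS => w wz; apply: (unconditional_solid cK sK Kz) => i.
exact: ltW.
Qed.

(** * Exchanging coordinates *)

(** The point is a convex combination of |x|, the vector of moduli of x, with
    its images under the transpositions of j and k for k in A, each of weight
    tau.  The transposition of j and k only changes the coordinates j and k,
    so each k in A contributes one term to the loss at j. *)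
Lemma transfer_mass (R : realType) (n : nat) (K : set 'rV[R]_n)
    (x : 'rV[R]_n) (j : 'I_n) (A : {set 'I_n}) (tau : R) :
  convex_set K -> one_symmetric K -> K x ->
  j \notin A -> 0 <= tau -> #|A|%:R * tau <= 1 ->
  K (\row_i (if i == j then `|x 0 j| - \sum_(k in A) tau * (`|x 0 j| - `|x 0 k|)
             else if i \in A then `|x 0 i| + tau * (`|x 0 j| - `|x 0 i|)
             else `|x 0 i|)).
Proof.
move=> cK sK Kx jA tau0 Atau.
pose a : 'rV[R]_n := \row_i `|x 0 i|.
have Ka : K a.
  by apply: (unconditional_solid cK sK Kx) => i; rewrite mxE normr_id.
pose v k : 'rV[R]_n := \row_i a 0 (tperm j k i).
have Kv k : K (v k).
  congr (K _): (sK (fun=> false) (tperm j k) a Ka).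
  by apply/rowP => i; rewrite !mxE expr0 mul1r.
have [u Ku uE] := convex_set_sum (index_enum 'I_n) (mem A) cK
  (ex_intro _ a Ka) (fun=> tau0) Kv.
have sumA : \sum_(k in A) tau = #|A|%:R * tau.
  by rewrite sumr_const mulr_natl.
have At0 : 0 <= #|A|%:R * tau by rewrite mulr_ge0.
have t01 : 0 <= #|A|%:R * tau <= 1 by rewrite At0.
congr (K _): (convex_set_comb cK t01 Ku Ka).
rewrite -sumA -uE scalerBl scale1r scaler_suml addrCA -sumrB.
apply/rowP => i; rewrite !mxE summxE.
under eq_bigr => k kA do rewrite !mxE -mulrBr.
have [->|ij] := eqVneq i j.
  rewrite -sumrN; congr (_ + _); apply: eq_bigr => k kA.
  by rewrite tpermL -mulrN opprB.
have other k : k != i -> tau * (`|x 0 (tperm j k i)| - `|x 0 i|) = 0.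
  by move=> ki; rewrite tpermD // ?subrr ?mulr0 // eq_sym.
case: ifP => iA.
  rewrite (bigD1 i) //= tpermR big1 ?addr0 // => k /andP[_ ki].
  exact: other.
rewrite big1 ?addr0 // => k kA; apply: other.
by apply: contraFneq iA => <-.
Qed.
(** * Norm-one basis vectors *)

Lemma exists_pos_lt (R : realType) (I : finType) (P : pred I) (F : I -> R) :
  (forall i, P i -> 0 < F i) ->
  exists2 e, 0 < e < 1 & forall i, P i -> e < F i.
Proof.
move=> F0; set m := \big[Num.min/1]_(i | P i) F i.
have m0 : 0 < m by apply: lt_bigmin.
have m1 : m <= 1 by exact: bigmin_le_id.
exists (m / 2) => [|i Pi]; first by lra.
by have : m <= F i by [exact: bigmin_le_cond]; lra.
Qed.

Lemma has_lbound_gauge (R : realType) (n : nat) (K : set 'rV[R]_n)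
    (x : 'rV[R]_n) :
  has_lbound [set t : R | 0 < t /\ [set t *: y | y in K] x].
Proof. by exists 0 => t [/ltW]. Qed.

Lemma gauge_norm_le (R : realType) (n : nat) (K : set 'rV[R]_n)
    (y : 'rV[R]_n) (t : R) :
  0 < t -> K y -> gauge_norm K (t *: y) <= t.
Proof.
move=> t0 Ky; apply: ge_inf; first exact: has_lbound_gauge.
by split=> //; exists y.
Qed.

Lemma basis_vecE (R : realType) (n : nat) (i k : 'I_n) :
  basis_vec R i 0 k = (k == i)%:R.
Proof. by rewrite mxE eqxx. Qed.

(** The gauge of the i-th basis vector is an infimum that need not be attained
    a priori; it only shows that the multiples of the vector by factors c < 1
    belong to K, and closedness of K gives the limit c = 1. *)
Lemma sym_body_basis (R : realType) (n : nat) (K : set 'rV[R]_n) (i : 'I_n) :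
  sym_body_class K -> K (basis_vec R i).
Proof.
move=> [[kK cK _] sK gK].
have clK : closed K by apply: compact_closed => //; exact: norm_hausdorff.
have Kc (c : R) : 0 < c < 1 -> K (c *: basis_vec R i).
  move=> /andP[c0 c1].
  set S := [set t : R | 0 < t /\ [set t *: y | y in K] (basis_vec R i)].
  have iS : inf S = 1 := gK i.
  have hS : has_inf S.
    apply: contrapT => /inf_out; rewrite iS => /eqP.
    by rewrite oner_eq0.
  have c'0 : 0 < c^-1 - 1 by rewrite subr_gt0 invf_gt1.
  have [t [t0 [y Ky yE]]] := inf_adherent c'0 hS.
  rewrite iS addrC subrK => tc.
  apply: (unconditional_solid cK sK Ky) => k; rewrite mxE -yE mxE.
  rewrite mulrA normrM ler_piMl // ger0_norm ?mulr_ge0 ?ltW //.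
  by rewrite mulrC -ltr_pdivlMr // mul1r.
have cvg1 : (fun c : R => c *: basis_vec R i) @ (1 : R)^'- --> 1 *: basis_vec R i.
  apply: cvgZr_tmp; exact: cvg_at_left_filter.
rewrite -[basis_vec R i]scale1r.
apply: (closed_cvg K clK _ _ cvg1).
near=> c; apply: Kc; apply/andP; split; near: c.
  exact: nbhs_left_gt.
exact: nbhs_left_lt.
Unshelve. all: by end_near. Qed.

Lemma sym_body_coord_le1 (R : realType) (n : nat) (K : set 'rV[R]_n)
    (x : 'rV[R]_n) (i : 'I_n) :
  sym_body_class K -> K x -> `|x 0 i| <= 1.
Proof.
move=> [[_ cK _] sK gK] Kx; rewrite leNgt; apply/negP => x1.
have x0 : 0 < `|x 0 i| by exact: lt_trans x1.
have Ke : K (`|x 0 i| *: basis_vec R i).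
  apply: (unconditional_solid cK sK Kx) => k; rewrite mxE basis_vecE.
  by case: eqP => [->|_]; rewrite ?mulr1 ?mulr0 ?normr_id ?normr0.
have xV0 : 0 < `|x 0 i|^-1 by rewrite invr_gt0.
have := gauge_norm_le xV0 Ke.
by rewrite scalerA mulVf ?gt_eqF // scale1r gK leNgt invf_lt1 // x1.
Qed.

(** * Two criteria for interior points *)

(** Equality in the coordinate l is harmless below height 1: a small amount of
    the l-th basis vector raises that coordinate, and the strict inequalities
    elsewhere survive. *)
Lemma interior_off_axis (R : realType) (n : nat) (K : set 'rV[R]_n)
    (y z : 'rV[R]_n) (l : 'I_n) :
  convex_set K -> one_symmetric K -> K (basis_vec R l) -> K z ->
  (forall i, i != l -> `|y 0 i| < `|z 0 i|) ->
  `|y 0 l| <= `|z 0 l| -> `|y 0 l| < 1 -> K° y.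
Proof.
move=> cK sK Kl Kz yz yzl yl1.
have Ka : K (\row_i `|z 0 i|).
  by apply: (unconditional_solid cK sK Kz) => i; rewrite mxE normr_id.
have z0 i : i != l -> 0 < `|z 0 i| by move=> /yz; apply: le_lt_trans.
have [|e /andP[e0 e1] ez] := @exists_pos_lt R _ (fun i => i != l)
    (fun i => 1 - `|y 0 i| / `|z 0 i|).
  move=> i il; rewrite subr_gt0 ltr_pdivrMr ?mul1r; [exact: yz|exact: z0].
have e01 : 0 <= e <= 1 by rewrite !ltW.
apply: (solid_interior cK sK (convex_set_comb cK e01 Kl Ka)) => i.
rewrite !mxE eqxx /=.
have [->|il] := eqVneq i l.
  by rewrite mulr1; apply: lt_le_trans (ler_norm _); nra.
rewrite mulr0 add0r; apply: lt_le_trans (ler_norm _).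
have := ez i il; rewrite ltrBrDr -ltrBrDl ltr_pdivrMr ?z0 //.
Qed.

(** The height 1 - |y l| left free at l is shared among the other coordinates;
    as these are below height 1, each exchange with l raises them strictly. *)
Lemma interior_under_tip (R : realType) (n : nat) (K : set 'rV[R]_n)
    (x y : 'rV[R]_n) (l : 'I_n) :
  convex_set K -> one_symmetric K -> K x -> `|x 0 l| = 1 ->
  (forall i, i != l -> `|x 0 i| < 1) ->
  (forall i, i != l -> `|y 0 i| <= `|x 0 i|) ->
  `|y 0 l| < 1 -> K° y.
Proof.
move=> cK sK Kx xl x1 yx yl1.
pose A : {set 'I_n} := [set~ l]%SET.
(* The denominator n.+1 exceeds the number of recipients, so that not all of
   the free height is spent. *)
pose tau := (1 - `|y 0 l|) / n.+1%:R.
have N0 : 0 < n.+1%:R :> R by rewrite ltr0n.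
have y0 : 0 <= `|y 0 l| by [].
have tau0 : 0 < tau by rewrite divr_gt0 // subr_gt0.
have tauN : n.+1%:R * tau = 1 - `|y 0 l| by rewrite /tau mulrCA divff ?mulr1 ?gt_eqF.
have card_tau : #|A|%:R * tau < 1 - `|y 0 l|.
  rewrite -tauN ltr_pM2r // ltr_nat ltnS.
  by rewrite -[leqRHS]card_ord max_card.
have l_notin : l \notin A by rewrite !inE eqxx.
have card_le1 : #|A|%:R * tau <= 1 by lra.
have Kz := transfer_mass cK sK Kx l_notin (ltW tau0) card_le1.
apply: (solid_interior cK sK Kz) => i.
rewrite mxE xl !inE.
have [->|il] /= := eqVneq i l; apply: lt_le_trans (ler_norm _).
  suff : \sum_(k in A) tau * (1 - `|x 0 k|) <= #|A|%:R * tau.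
    by lra.
  rewrite mulr_natl -sumr_const; apply: ler_sum => k _.
  by rewrite ger_pMr // lerBlDr lerDl.
apply: le_lt_trans (yx i il) _.
by rewrite ltrDl mulr_gt0 // subr_gt0 x1.
Qed.
(** * Illumination of the boundary *)

(** Along d the coordinate j loses e, while a zero coordinate gains at most
    e / n.+1.  Besides j and l there are at most n.-1 coordinates, so j can
    grant e / n to each zero coordinate and still lose less than e. *)
Lemma illuminates_off_axis (R : realType) (n : nat) (K : set 'rV[R]_n.+1)
    (x d : 'rV[R]_n.+1) (j l : 'I_n.+1) :
  convex_set K -> one_symmetric K -> K (basis_vec R l) -> K x ->
  j != l -> `|x 0 l| < 1 -> d 0 l = 0 -> x 0 j != 0 -> `|d 0 j| = 1 ->
  (forall i, i != l -> `|d 0 i| <= 1) ->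
  (forall i, i != l -> x 0 i != 0 -> Num.sg (x 0 i) = - Num.sg (d 0 i)) ->
  (forall i, i != l -> x 0 i = 0 -> `|d 0 i| <= 1 / n.+1%:R) ->
  illuminates_point K d x.
Proof.
move=> cK sK Kl Kx jl xl1 dl xj dj d1 sgd dsmall.
have n0 : (0 < n)%N.
  by have := max_card [set j; l]%SET; rewrite cards2 jl card_ord.
have nR0 : 0 < n%:R :> R by rewrite ltr0n.
have [|e /andP[e0 e1] ex] := @exists_pos_lt R _ (fun i => x 0 i != 0)
    (fun i => `|x 0 i|).
  by move=> i; rewrite normr_gt0.
exists e => //.
pose A : {set 'I_n.+1} := [set i | (x 0 i == 0) && (i != l)]%SET.
have jA : j \notin A by rewrite inE (negbTE xj).
have cardA : (#|A| < n)%N.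
  suff : (#|A| <= #|(~: [set j; l])%SET|)%N.
    by rewrite (cardsCs (~: [set j; l])%SET) finset.setCK cards2 jl card_ord subSS subn1 -ltnS prednK.
  apply: subset_leq_card; apply/fintype.subsetP => i; rewrite !inE negb_or.
  by move=> /andP[/eqP xi ->]; rewrite andbT; apply: contraNneq xj => <-; rewrite xi.
have xj0 : 0 < `|x 0 j| by rewrite normr_gt0.
(* With this tau each zero coordinate receives e / n: more than its gain of
   at most e / n.+1 along d, and fewer than n coordinates share e. *)
pose tau := e / n%:R / `|x 0 j|.
have tau0 : 0 < tau by rewrite !divr_gt0.
have tauxj : tau * `|x 0 j| = e / n%:R by rewrite /tau divfK ?gt_eqF.
have lost : #|A|%:R * (e / n%:R) < e.
  by rewrite mulrA ltr_pdivrMr // mulrC ltr_pM2l // ltr_nat.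
have card_le1 : #|A|%:R * tau <= 1.
  rewrite /tau mulrA ler_pdivrMr // mul1r; apply: ltW.
  by apply: (lt_trans lost); exact: ex.
have Kz := transfer_mass cK sK Kx jA (ltW tau0) card_le1.
have yE i : i != l -> x 0 i != 0 ->
    `|x 0 i + e * d 0 i| = `|x 0 i| - e * `|d 0 i|.
  move=> il xi.
  have {1}-> : d 0 i = - (Num.sg (x 0 i) * `|d 0 i|).
    by rewrite sgd // mulNr opprK -numEsg.
  rewrite {1}[x 0 i]numEsg mulrN mulrCA -mulrBr normrM normr_sg xi mul1r.
  rewrite ger0_norm // subr_ge0; apply: le_trans (ltW (ex i xi)).
  by rewrite ler_piMr ?d1 // ltW.
(* The direction d does not move the coordinate l, and the transfer keeps it,
   because A does not contain l. *)
apply: (interior_off_axis cK sK Kl Kz); last 2 first.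
- rewrite !mxE dl mulr0 addr0 eq_sym (negbTE jl) inE eqxx andbF.
  by rewrite normr_id.
- by rewrite !mxE dl mulr0 addr0.
move=> i il; rewrite !mxE; apply: lt_le_trans (ler_norm _).
have [->|ij] := eqVneq i j.
  rewrite yE // dj mulr1 ltrD2l ltrN2.
  rewrite (_ : \sum_(k in A) _ = #|A|%:R * (e / n%:R)) //.
  rewrite mulr_natl -sumr_const; apply: eq_bigr => k.
  by rewrite inE => /andP[/eqP -> _]; rewrite normr0 subr0.
rewrite inE il andbT; have [xi|xi] := eqVneq (x 0 i) 0.
  rewrite xi normr0 !add0r subr0 tauxj normrM gtr0_norm // ltr_pM2l //.
  apply: (le_lt_trans (dsmall i il xi)).
  by rewrite mul1r ltf_pV2 ?posrE ?ltr0n // ltr_nat.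
rewrite yE // ltrBlDr ltrDl mulr_gt0 // normr_gt0 -sgr_eq0 -oppr_eq0 -sgd //.
by rewrite sgr_eq0.
Qed.

Lemma append0_max (R : realType) (n : nat) (d : 'rV[R]_n) :
  append0 d 0 ord_max = 0.
Proof. by rewrite mxE unlift_none. Qed.

Lemma append0_lift (R : realType) (n : nat) (d : 'rV[R]_n) (i : 'I_n) :
  append0 d 0 (lift ord_max i) = d 0 i.
Proof. by rewrite mxE liftK. Qed.

Lemma deep_illumination_illuminates (R : realType) (n : nat)
    (B : set 'rV[R]_n.+1) (I : set 'rV[R]_n) :
  sym_body_class B ->
  (forall i j : 'I_n.+1, (i < j)%N ->
     1 < gauge_norm B (basis_vec R i + basis_vec R j)) ->
  I `<=` Gset (1 / n.+1%:R) ->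
  (forall x : 'rV[R]_n, x != 0 -> deep_illuminates I x) ->
  illuminates
    ([set append0 d | d in I] `|`
     [set basis_vec R ord_max; - basis_vec R ord_max]) B.
Proof.
move=> hB hee IG deepI; have [[kB cB _] sB gB] := hB.
have Be i := sym_body_basis i hB.
have e_neq0 (i : 'I_n.+1) : basis_vec R i != 0.
  apply/eqP => /matrixP/(_ 0 i); rewrite basis_vecE eqxx mxE => /eqP.
  by rewrite oner_eq0.
have not_pair (i j : 'I_n.+1) : i != j -> ~ B (basis_vec R i + basis_vec R j).
  wlog ij : i j / (i < j)%N => [W ij|_].
    have := ij; rewrite neq_ltn => /orP[/W|/W]; first exact.
    by rewrite addrC eq_sym; exact.
  move/(gauge_norm_le ltr01); rewrite scale1r leNgt => /negP; apply.
  exact: hee.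
have clB : closed B by apply: compact_closed => //; exact: norm_hausdorff.
split=> [d [[d' /IG[i [di _]] <-]|[->|->]]|x].
- apply: contra_eq_neq di => /rowP/(_ (lift ord_max i)).
  rewrite append0_lift mxE => ->.
  by rewrite normr0 eq_sym oner_eq0.
- exact: e_neq0.
- by rewrite oppr_eq0 e_neq0.
rewrite /boundary -((closure_id B).1 clB) => -[Bx Nx].
have [xl1|xl1] := eqVneq `|x 0 ord_max| 1.
  (* The step 1 brings the last coordinate to 0, far enough below the tip. *)
  exists (- Num.sg (x 0 ord_max) *: basis_vec R ord_max).
    right; have xl0 : x 0 ord_max != 0 by rewrite -normr_gt0 xl1.
    case: sgrP xl0 => // _ _; [right|left].
      by rewrite scaleN1r.
    by rewrite opprK scale1r.
  exists 1 => //; apply: (interior_under_tip (x := x) cB sB Bx xl1).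
  - move=> i il; rewrite lt_neqAle (sym_body_coord_le1 i hB Bx) andbT.
    apply/negP => /eqP xi1; apply: (not_pair i ord_max il).
    apply: (unconditional_solid cB sB Bx) => k; rewrite mxE !basis_vecE.
    have [->|ki] := eqVneq k i; first by rewrite (negbTE il) addr0 normr1 xi1.
    have [->|kl] := eqVneq k ord_max; first by rewrite add0r normr1 xl1.
    by rewrite addr0 normr0.
  - move=> i il; rewrite !mxE eqxx (negbTE il) /=.
    by rewrite !mulr0 addr0.
  - rewrite !mxE !eqxx /= mulr1 mul1r.
    by rewrite {1}[x 0 ord_max]numEsg xl1 mulr1 subrr normr0.
have {}xl1 : `|x 0 ord_max| < 1.
  by rewrite lt_neqAle xl1 (sym_body_coord_le1 _ hB).
have lift_ord (i : 'I_n.+1) : i != ord_max -> {k | i = lift ord_max k}.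
  by move=> il; case: (unliftP ord_max i) il => [k ->|->]; [exists k|rewrite eqxx].
pose x' : 'rV[R]_n := \row_i x 0 (lift ord_max i).
have [x'0|x'0] := eqVneq x' 0.
  (* On the open axis segment x lies strictly below the tip, hence inside B. *)
  case: Nx; apply: (interior_under_tip (l := ord_max) cB sB (Be ord_max)) => //.
  - by rewrite basis_vecE eqxx normr1.
  - by move=> i il; rewrite basis_vecE (negbTE il) normr0.
  - move=> i /lift_ord[k ->].
    by have /rowP/(_ k) := x'0; rewrite !mxE => ->; rewrite normr0.
have [d Id [sgd [j xj dj]]] := deepI _ x'0.
have [i0 [di0 dother]] := IG _ Id.
exists (append0 d); first by left; exists d.
have N1 : 1 / n.+1%:R <= 1 :> R by rewrite ler_pdivrMr ?mul1r ?ler1n ?ltr0n.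
apply: (illuminates_off_axis (j := lift ord_max j) (l := ord_max)) => //.
- by rewrite eq_sym neq_lift.
- exact: append0_max.
- by rewrite mxE in xj.
- by rewrite append0_lift.
- move=> i /lift_ord[k ->]; rewrite append0_lift.
  by have [->|ki] := eqVneq k i0; rewrite ?di0 // dother.
- move=> i /lift_ord[k ->] xk; rewrite append0_lift.
  by have := sgd k; rewrite mxE; exact.
- move=> i /lift_ord[k ->] xk; rewrite append0_lift.
  have [ki|/dother -> //] := eqVneq k i0.
  (* Since 1 / n.+1 < 1, the entry of modulus 1 is unique, so it sits at j. *)
  have ji0 : j = i0.
    apply/eqP; apply: contra_eqT dj => /dother ->.
    rewrite lt_eqF // ltr_pdivrMr ?mul1r ?ltr1n ?ltr0n // ltnS.
    exact: leq_ltn_trans (ltn_ord j).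
  by move: xj; rewrite mxE ji0 -ki xk eqxx.
Qed.
(** * A deep illuminating family indexed by sign vectors *)

Definition run_end (n : nat) (e : 'I_n -> bool) (k : 'I_n) : bool :=
  [forall i : 'I_n, (i <= k)%N ==> (e i == e k)] &&
  [forall i : 'I_n, (i == k.+1 :> nat) ==> (e i != e k)].

Lemma run_end_exists (n : nat) (e : 'I_n -> bool) (i0 : 'I_n) :
  exists k, run_end e k.
Proof.
have n0 : (0 < n)%N by exact: leq_ltn_trans (ltn_ord i0).
pose const_upto (k : 'I_n) := [forall i : 'I_n, (i <= k)%N ==> (e i == e k)].
have const0 : const_upto (Ordinal n0).
  apply/fintype.forallP => i; apply/implyP; rewrite leqn0 => /eqP i_0.
  by apply/eqP; congr e; exact: val_inj.
have [k kP kmax] := @arg_maxnP _ (Ordinal n0) const_upto (@nat_of_ord n) const0.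
exists k; apply/andP; split=> //.
apply/fintype.forallP => i; apply/implyP => /eqP ik; apply/negP => /eqP eik.
have /kmax : const_upto i.
  apply/fintype.forallP => l; apply/implyP; rewrite ik leq_eqVlt ltnS.
  case/orP => [/eqP lk|lk].
    by apply/eqP; congr e; apply: val_inj; rewrite /= ik.
  by rewrite eik; move/fintype.forallP/(_ l)/implyP: kP; exact.
by rewrite /= ik ltnn.
Qed.

Lemma run_end_unique (n : nat) (e : 'I_n -> bool) (j k : 'I_n) :
  run_end e j -> run_end e k -> j = k.
Proof.
have W (a b : 'I_n) : run_end e a -> run_end e b -> ~ (a < b)%N.
  move=> /andP[_ /fintype.forallP aend] /andP[/fintype.forallP bconst _] ab.
  have a1n : (a.+1 < n)%N by exact: leq_ltn_trans (ltn_ord b).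
  have := aend (Ordinal a1n); rewrite eqxx /=.
  have /implyP/(_ ab)/eqP -> := bconst (Ordinal a1n).
  by have /implyP/(_ (ltnW ab))/eqP -> := bconst a; rewrite eqxx.
move=> ej ek; have [jk|kj|/val_inj //] := ltngtP j k.
  by case: (W j k ej ek jk).
by case: (W k j ek ej kj).
Qed.

Definition run_dir (R : realType) (n : nat) (delta : R) (e : {ffun 'I_n -> bool}) :
    'rV[R]_n :=
  \row_i ((-1) ^+ e i * (if run_end e i then 1 else delta)).

Lemma sg_run_dir (R : realType) (n : nat) (delta : R)
    (e : {ffun 'I_n -> bool}) (i : 'I_n) :
  0 < delta -> Num.sg (run_dir delta e 0 i) = (-1) ^+ e i.
Proof.
move=> delta0; rewrite mxE sgrM.
rewrite [X in _ * X](_ : _ = 1) ?mulr1; last by case: ifP => _; rewrite gtr0_sg.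
by case: (e i); rewrite ?expr1 ?expr0 ?sgrN sgr1.
Qed.

Lemma card_finType (T : finType) : [set: T] #= `I_#|T|.
Proof.
have rankT : enum_rank @` [set: T] = [set: 'I_#|T|].
  by apply/seteqP; split=> // i _; exists (enum_val i); rewrite ?enum_valK.
rewrite (card_eqr card_II) -rankT; apply: card_esym.
exact: inj_card_eq (in2W enum_rank_inj).
Qed.

(** Given x, let j be its first nonzero coordinate, and choose the sign vector
    opposite to x on the support of x, constant up to j, and opposite to that
    constant on the zero coordinates after j.  The initial run then reaches j
    and cannot end at a zero coordinate, so its end lies in the support. *)
Lemma deep_illuminating_set_exists (R : realType) (n : nat) (delta : R) :
  (0 < n)%N -> 0 < delta ->
  exists I : set 'rV[R]_n,
    [/\ I `<=` Gset delta, I #= `I_(2 ^ n) &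
        forall x, x != 0 -> deep_illuminates I x].
Proof.
move=> n0 delta0; exists (range (@run_dir R n delta)); split.
- move=> _ [e _ <-]; have [k ek] := run_end_exists e (Ordinal n0).
  exists k; split=> [|j jk].
    by rewrite mxE ek mulr1 normrX normrN1 expr1n.
  rewrite mxE normrM normrX normrN1 expr1n mul1r ifN ?gtr0_norm //.
  by apply: contra_neqN jk => ej; exact: run_end_unique ej ek.
- have dir_inj : injective (@run_dir R n delta).
    move=> e e' ee'; apply/ffunP => i.
    have := congr1 (fun d : 'rV[R]_n => Num.sg (d 0 i)) ee'.
    rewrite /= !sg_run_dir // => /eqP.
    by case: (e i) (e' i) => [] []; rewrite // ?expr0 ?expr1 => /eqP; lra.
  apply: card_eq_trans (inj_card_eq (in2W dir_inj)) _.
  have <- : #|{ffun 'I_n -> bool}| = (2 ^ n)%N.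
    by rewrite card_ffun card_bool card_ord.
  exact: card_finType.
- move=> x /matrix0Pn[i [j0]]; rewrite ord1 => xj0.
  have [j xj jmin] := @arg_minnP _ j0 (fun j => x 0 j != 0) (@nat_of_ord n) xj0.
  (* The value true encodes the sign -1, hence a positive entry of x. *)
  pose e : {ffun 'I_n -> bool} := [ffun i : 'I_n =>
    if x 0 i != 0 then 0 < x 0 i else
    if (i < j)%N then 0 < x 0 j else ~~ (0 < x 0 j)].
  exists (run_dir delta e); first by exists e.
  split=> [k xk|].
    rewrite sg_run_dir // ffunE xk; case: sgrP xk => // _ _.
    by rewrite expr1 opprK.
  have [k ek] := run_end_exists e j.
  exists k; last by rewrite mxE ek mulr1 normrX normrN1 expr1n.
  move: ek => /andP[/fintype.forallP kconst /fintype.forallP kend].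
  apply/negP => /eqP xk.
  have [kj|jk|kj] := ltngtP k j.
  + have k1n : (k.+1 < n)%N by exact: leq_ltn_trans (ltn_ord j).
    have := kend (Ordinal k1n); rewrite eqxx /= !ffunE xk eqxx /= kj.
    have [xk1|xk1] /= := eqVneq (x 0 (Ordinal k1n)) 0; last first.
      have /val_inj <- : \val (Ordinal k1n) = \val j.
        by apply/eqP; rewrite eqn_leq kj (jmin _ xk1).
      by rewrite eqxx.
    have /= -> : (k.+1 < j)%N; last by rewrite eqxx.
    rewrite ltn_neqAle kj andbT; apply: contraNneq xj => k1j.
    by rewrite -xk1; apply/eqP; congr (x 0 _); exact: val_inj.
  + have /implyP/(_ (ltnW jk)) := kconst j.
    by rewrite !ffunE xj xk eqxx /= ltnNge (ltnW jk) /=; case: (0 < x 0 j).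
  + by move: xj; rewrite -(val_inj kj) xk eqxx.
Qed.

(** * The illumination number *)

Lemma illumination_number_le (R : realType) (n m : nat) (D B : set 'rV[R]_n) :
  illuminates D B -> D #<= `I_m -> (illumination_number B <= (m%:R)%:E)%E.
Proof.
move=> DB Dm.
have [k Dk] : exists k, D #= `I_k.
  by apply/finite_setP/finite_set_leP; exists m.
apply: (@le_trans _ _ (k%:R)%:E).
  by apply: ereal_inf_lbound; exists k => //; exists D.
by rewrite lee_fin ler_nat -card_le_II -(card_le_eql Dk).
Qed.

Lemma card_leU (T : choiceType) (A B : set T) (a b : nat) :
  A #<= `I_a -> B #<= `I_b -> A `|` B #<= `I_(a + b).
Proof.
move=> Aa Bb.
have finA : finite_set A by apply/finite_set_leP; exists a.
have finB : finite_set B by apply/finite_set_leP; exists b.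
have finAB : finite_set (A `|` B) by rewrite finite_setU.
have /finite_setP[m ABm] := finAB.
rewrite (card_le_eql ABm) card_le_II -(card_fset_set ABm) fset_setU //.
rewrite finmap.cardfsU; apply: leq_trans (leq_subr _ _) _.
by apply: leq_add; exact: geq_card_fset_set.
Qed.

Lemma card_le_pair (T : choiceType) (x y : T) : [set x; y] #<= `I_2.
Proof.
have one (z : T) : [set z] #<= `I_1.
  have -> : [set z] = (fun=> z) @` `I_1.
    by apply/seteqP; split=> [w ->|w [k _ <-]] //; exists 0%N.
  exact: card_image_le.
exact: (card_leU (one x) (one y)).
Qed.

Theorem theorem19 (R : realType) (n : nat) (hn : (3 <= n.+1)%N)
    (B : set 'rV[R]_n.+1) (hB : sym_body_class B)
    (hee : forall i j : 'I_n.+1, (i < j)%N ->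
       1 < gauge_norm B (basis_vec R i + basis_vec R j)) :
  (forall I : set 'rV[R]_n,
     I `<=` Gset (1 / n.+1%:R) ->
     I #= `I_(2 ^ n) ->
     (forall x : 'rV[R]_n, x != 0 -> deep_illuminates I x) ->
     illuminates
       ([set append0 d | d in I] `|`
        [set basis_vec R ord_max; - basis_vec R ord_max]) B) /\
  (illumination_number B <= ((2 ^ n + 2)%N%:R)%:E)%E.
Proof.
have part1 (I : set 'rV[R]_n) := deep_illumination_illuminates hB hee (I := I).
split=> [I IG _ deepI|]; first exact: part1.
have n0 : (0 < n)%N by case: n hn {B hB hee part1}.
have delta0 : 0 < 1 / n.+1%:R :> R by rewrite divr_gt0 ?ltr0n.
have [I [IG Icard deepI]] := deep_illuminating_set_exists n0 delta0.
apply: illumination_number_le (part1 I IG deepI) _.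
apply: card_leU; last exact: card_le_pair.
by rewrite -(card_le_eqr Icard) card_image_le.
Qed.
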